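(* Let $C$ be a non-empty finite set, let $(G,+,\le)$ be a totally ordered group, and let $\mathrm{val}\colon C\to G$ be any valuation of colors. Then the energy condition $W\subseteq C^\omega$ over $(G,+,\le)$ defined by $\mathrm{val}$ is bi-positional.
   Context: For a set $C$, $C^*$, $C^\omega$ denote the sets of finite and infinite words over $C$. **Energy conditions.** A totally ordered group is a triple $(G,+,\le)$ where $(G,+)$ is a (not necessarily abelian) group and $\le$ is a total order on $G$ such that $a\le b$ implies $x+a+y\le x+b+y$ for all $a,b,x,y\in G$. A valuation of colors is a function $\mathrm{val}\colon C\to G$, extended to $C^*$ by $\mathrm{val}(\text{empty word})=0$, $\mathrm{val}(c_1\ldots c_n)=\mathrm{val}(c_1)+\ldots+\mathrm{val}(c_n)$. The energy condition over $(G,+,\le)$ defined by $\mathrm{val}$ is the set of all $c_1c_2c_3\ldots\in C^\omega$ such that the sequence $\{\mathrm{val}(c_1\ldots c_n)\}_{n=1}^\infty$ has an infinite (strictly) decreasing subsequence w.r.t. $\le$. **Arenas and games.** An arena over a non-empty finite set (of colors) $C$ is a tuple $\langle V_A,V_B,E\rangle$ where $V_A,V_B$ are disjoint finite sets and $E\subseteq (V_A\cup V_B)\times C\times (V_A\cup V_B)$ is such that every $s\in V_A\cup V_B$ has some $(s,c,t)\in E$. Nodes in $V_A$ are Alice's, nodes in $V_B$ are Bob's. For an edge $e=(s,c,t)$, put $\mathrm{source}(e)=s$, $\mathrm{col}(e)=c$, $\mathrm{target}(e)=t$. The infinite-duration game from a node $s$: starting at $s$, at each turn the owner of the current node chooses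 an edge whose source is the current node, and the play moves to the target of this edge. This gives an infinite path $e_1,e_2,e_3,\ldots$ (a play). A strategy of a player selects an edge at each of that player's turns depending on the path so far. A winning condition is a set $W\subseteq C^\omega$. A strategy of Alice is winning from $s$ w.r.t. $W$ if every play from $s$ consistent with it satisfies $\mathrm{col}(e_1)\mathrm{col}(e_2)\mathrm{col}(e_3)\ldots\in W$; a strategy of Bob is winning from $s$ w.r.t. $W$ if every play from $s$ consistent with it satisfies $\mathrm{col}(e_1)\mathrm{col}(e_2)\ldots\notin W$. A positional strategy of Alice is a function $\sigma\colon V_A\to E$ with $\mathrm{source}(\sigma(u))=u$ for all $u\in V_A$ (whenever at $u$, Alice chooses $\sigma(u)$); positional strategies of Bob are defined analogously on $V_B$. $W$ is half-positional if for every (finite) arena over $C$ there is a positional strategy $\sigma$ of Alice such that for every node $s$: if $\sigma$ is not winning w.r.t. $W$ from $s$, then Bob has a winning strategy w.r.t. $W$ from $s$. $W$ is bi-positional if both $W$ and $C^\omega\setminus W$ are half-positional. *)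

(* Defs.v *)
From HB Require Import structures.
From mathcomp Require Import all_boot all_order.
From mathcomp Require Import classical_sets.

Set Implicit Arguments.
Unset Strict Implicit.
Unset Printing Implicit Defensive.

(* Totally ordered groups, possibly infinite and not necessarily abelian.
   MathComp's non-commutative groups are written multiplicatively, so [*%g] and
   [1%g] play the roles of + and 0. *)
HB.mixin Record isOrderedGroup (d : Order.disp_t) G
    of monoid.Group G & Order.Total d G := {
  ordg_le_mul2 : forall a b x y : G, (a <= b)%O -> (x * a * y <= x * b * y)%O%g
}.

#[short(type="orderedGroupType")]
HB.structure Definition OrderedGroup (d : Order.disp_t) :=
  { G of monoid.Group G & Order.Total d G & isOrderedGroup d G }.

(* The infinite word c_1 c_2 c_3 ... is encoded as w with w n = c_(n+1). *)
Definition omega_word (C : Type) := nat -> C.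

Section Energy.
Context {d : Order.disp_t} {G : orderedGroupType d} {C : finType}.

Definition word_val (val : C -> G) (u : seq C) : G := (\prod_(c <- u) val c)%g.

(* [f] enumerates the indices of the subsequence of {val(c_1...c_n)}_{n >= 1};
   [mkseq w n] is the prefix c_1...c_n. *)
Definition energy_condition (val : C -> G) : set (omega_word C) :=
  [set w | exists f : nat -> nat,
    [/\ forall i, 0 < f i,
        {homo f : i j / i < j}
      & forall i j, i < j ->
          (word_val val (mkseq w (f j)) < word_val val (mkseq w (f i)))%O]].

End Energy.

Record arena (C : finType) := Arena {
  nodeA : finType;
  nodeB : finType;
  edges : {set (nodeA + nodeB) * C * (nodeA + nodeB)};
  edges_total : forall s, exists c t, (s, c, t) \in edges
}.

Section Games.
Context {C : finType} (A : arena C).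

Definition node : finType := (nodeA A + nodeB A)%type.
Definition edge : Type := {e : node * C * node | e \in edges A}.

Definition source (e : edge) : node := (val e).1.1.
Definition col (e : edge) : C := (val e).1.2.
Definition target (e : edge) : node := (val e).2.

Fixpoint is_path (s : node) (h : seq edge) : Prop :=
  if h is e :: h' then source e = s /\ is_path (target e) h' else True.

Definition path_end (s : node) (h : seq edge) : node := last s (map target h).

Definition is_play (s : node) (p : nat -> edge) : Prop :=
  source (p 0) = s /\ forall n, source (p n.+1) = target (p n).

Definition play_word (p : nat -> edge) : omega_word C := col \o p.

Definition positional_strategyA (sigma : nodeA A -> edge) : Prop :=
  forall u, source (sigma u) = inl u.

Definition consistentA (sigma : nodeA A -> edge) (p : nat -> edge) : Prop :=
  forall n u, source (p n) = inl u -> p n = sigma u.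

Definition winningA (W : set (omega_word C)) (sigma : nodeA A -> edge)
    (s : node) : Prop :=
  forall p, is_play s p -> consistentA sigma p -> W (play_word p).

(* A general strategy sees the starting node and the edges played so far; its
   values matter only on paths that end in a node of Bob. *)
Definition strategyB (tau : node -> seq edge -> edge) : Prop :=
  forall s h v, is_path s h -> path_end s h = inr v -> source (tau s h) = inr v.

Definition consistentB (tau : node -> seq edge -> edge) (s : node)
    (p : nat -> edge) : Prop :=
  forall n v, source (p n) = inr v -> p n = tau s (mkseq p n).

Definition winningB (W : set (omega_word C)) (tau : node -> seq edge -> edge)
    (s : node) : Prop :=
  forall p, is_play s p -> consistentB tau s p -> ~ W (play_word p).

End Games.

Definition half_positional (C : finType) (W : set (omega_word C)) : Prop :=
  forall A : arena C, exists sigma : nodeA A -> edge A,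
    positional_strategyA sigma /\
    forall s : node A, ~ winningA W sigma s ->
      exists tau, strategyB tau /\ winningB W tau s.

Definition bi_positional (C : finType) (W : set (omega_word C)) : Prop :=
  half_positional W /\ half_positional (~` W)%classic.

(* Main.v *)
Require Import Defs.
From mathcomp Require Import all_boot all_order.
From mathcomp Require Import boolp.

(** The sign of a cycle decides everything.  Both orders of multiplication are
    monotone, so the sign of a product is invariant under rotation, and
    negative elements, like nonnegative ones, are closed under products
    ([ltg1_rot], [ltg1_mul]).  Along a play, the values of two prefixes that end
    in the same node differ by the weight of the cycle between them.  Hence a
    play all of whose cycles are negative satisfies the energy condition: some
    node recurs, and the prefixes that end there have decreasing values.  A play
    all of whose cycles are nonnegative violates it: a strictly decreasing
    subsequence would return to some node.

    It therefore suffices to split the nodes between two positional strategies,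
    one under which all reachable cycles are negative and one under which they
    are all nonnegative ([positional_determinacy]).  Since the two players of
    this cycle game are interchangeable, the same theorem serves for the energy
    condition and for its complement.

    Determinacy is proved by induction on the number of edges.  Let [e1] and
    [e2] be two edges out of a node [v], and remove one or the other.
    - If the owner of [v] wins from [v] in one of the two smaller games, the
      solution of that game is a solution of the whole: the opponent, where
      winning, never lets the play reach [v] ([determined_keep]).
    - Suppose that the opponent wins from [v] in both games, that negative
      cycles are good for the owner of [v] and that nonnegative ones are good
      for the opponent, with positional strategies [T true] and [T false].
      Wherever [T i] wins, cycles are nonnegative, so nodes have a finite or
      infinite distance to [v] in its graph.  The opponent plays, at each node,
      the strategy [T i] for which this distance is larger.  The larger distance
      is then a potential: one step along an edge decreases it by at most the
      weight of the edge, so cycles stay nonnegative ([determined_combine]).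
    - This argument treats the two signs differently, as a potential does not
      show that cycles are strictly negative.  It is first used up to the point
      where the player who wants negative cycles has no choice left.  Then there
      is nothing to combine when the other player branches, and cycles through
      [v] decompose into loops at [v] that live in one of the smaller games
      ([determined_union]).
    - When nobody has a choice, two cycles reachable from the same node are, up
      to rotation and powers, the same cycle ([det_cyc_sign]). *)

Set Implicit Arguments.
Unset Strict Implicit.
Unset Printing Implicit Defensive.

Import Order.TTheory.

(** * Signs of products in an ordered group *)

Section OrderedGroup.
Context {d : Order.disp_t} {G : orderedGroupType d}.
Local Open Scope group_scope.
Local Open Scope order_scope.
Implicit Types x y a b : G.

Lemma leg_mul2l x a b : a <= b -> x * a <= x * b.
Proof. by move=> /(@ordg_le_mul2 d G _ _ x 1); rewrite !mulg1. Qed.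

Lemma leg_mul2r x a b : a <= b -> a * x <= b * x.
Proof. by move=> /(@ordg_le_mul2 d G _ _ 1 x); rewrite !mul1g. Qed.

Lemma ltg_mul2l x a b : (x * a < x * b) = (a < b).
Proof.
rewrite !ltNge; congr (~~ _); apply/idP/idP; last exact: leg_mul2l.
by move/(leg_mul2l x^-1); rewrite !mulKg.
Qed.

Lemma ltg_mul2r x a b : (a * x < b * x) = (a < b).
Proof.
rewrite !ltNge; congr (~~ _); apply/idP/idP; last exact: leg_mul2r.
by move/(leg_mul2r x^-1); rewrite !mulgK.
Qed.

(** A product is turned into its rotation by conjugation, and conjugation
    preserves the order and fixes the neutral element. *)
Lemma ltg1_rot x y : (x * y < 1) = (y * x < 1).
Proof. by rewrite -(ltg_mul2l y) -(ltg_mul2r y _ 1) mulg1 mul1g mulgA. Qed.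

(** The boolean [s] is the sign, so that negative and nonnegative elements are
    treated alike. *)
Lemma ltg1_mul s x y : (x < 1) = s -> (y < 1) = s -> (x * y < 1) = s.
Proof.
case: s => [x1 y1|/negbT x1 /negbT y1].
  by apply: lt_trans y1; rewrite -[ltRHS]mul1g ltg_mul2r.
move: x1 y1; rewrite -!leNgt => x1 y1; apply/negbTE; rewrite -leNgt.
by apply: le_trans y1 _; rewrite -[leLHS]mul1g leg_mul2r.
Qed.

End OrderedGroup.

(** * Walks in a finite weighted graph *)

Section Walks.
Context {d : Order.disp_t} {G : orderedGroupType d}.
Context {V E : finType} (src tgt : E -> V) (w : E -> G).
Implicit Types (F S T : {set E}) (u v x s : V) (p q c r : seq E) (b : bool).

Fixpoint walk F u p : bool :=
  if p is e :: p' then [&& e \in F, src e == u & walk F (tgt e) p'] else true.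

Definition wend u p : V := last u (map tgt p).

Definition wt p : G := (\prod_(e <- p) w e)%g.

(** Without dead ends, a walk can be prolonged for ever; this is what makes
    cycles exist. *)
Definition total F := forall u, exists2 e, e \in F & src e = u.

Lemma wend_cons u e p : wend u (e :: p) = wend (tgt e) p.
Proof. by []. Qed.

Lemma wend_cat u p q : wend u (p ++ q) = wend (wend u p) q.
Proof. by rewrite /wend map_cat last_cat. Qed.

Lemma walk_cat F u p q : walk F u (p ++ q) = walk F u p && walk F (wend u p) q.
Proof. by elim: p u => //= e p IH u; rewrite IH /wend /= !andbA. Qed.

Lemma wtE p : wt p = (\prod_(e <- p) w e)%g.
Proof. by []. Qed.

Lemma wt_cat p q : wt (p ++ q) = (wt p * wt q)%g.
Proof. by rewrite /wt big_cat. Qed.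

Lemma wt_cons e p : wt (e :: p) = (w e * wt p)%g.
Proof. by rewrite /wt big_cons. Qed.

Lemma wt_nil : wt [::] = 1%g.
Proof. by rewrite /wt big_nil. Qed.

Lemma walk_sub F S u p : {subset F <= S} -> walk F u p -> walk S u p.
Proof.
move=> FS; elim: p u => //= e p IH u /and3P[eF -> wp].
by rewrite FS //= IH.
Qed.

(** By the pigeonhole principle, two prefixes end in the same node.  The cycle
    is singled out between a prefix and a suffix so that it can be cut out. *)
Lemma long_walk_cycle F u p : #|V| <= size p -> walk F u p ->
  exists p1 c p2,
    [/\ p = p1 ++ c ++ p2, c != [::] & wend u (p1 ++ c) = wend u p1].
Proof.
move=> lep wp; pose f (i : 'I_(#|V|.+1)) := wend u (take i p).
have /injectivePn[i [j neij eqf]] : ~~ injectiveb f.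
  apply/negP => /injectiveP /leq_card; rewrite card_ord.
  by rewrite ltnn.
wlog ltij : i j neij eqf / i < j.
  move=> H; case: (ltngtP i j) => [ij|ji|/val_inj eqij].
  - exact: (H i j).
  - by apply: (H j i) => //; rewrite eq_sym.
  - by rewrite eqij eqxx in neij.
have lejp : j <= size p by rewrite (leq_trans _ lep) // -ltnS.
exists (take i p), (take (j - i) (drop i p)), (drop j p).
have e1 : take i p ++ take (j - i) (drop i p) = take j p.
  by rewrite -takeD subnKC // ltnW.
split; last by rewrite e1 -/(f j) -eqf.
- by rewrite catA e1 cat_take_drop.
- rewrite -size_eq0 size_takel ?size_drop ?leq_sub2r //.
  by rewrite subn_eq0 -ltnNge.
Qed.

(** The objective of one player in the cycle game: negative cycles for [b =
    true], nonnegative ones for [b = false].  Cycles need not be simple. *)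
Definition cyc_sign b S s := forall p c,
  walk S s (p ++ c) -> wend s (p ++ c) = wend s p -> c != [::] ->
  (wt c < 1)%O%g = b.

Lemma cyc_sign_walk b S s p : cyc_sign b S s -> walk S s p ->
  cyc_sign b S (wend s p).
Proof.
move=> H wp q c wqc e c0; apply: (H (p ++ q)) => //.
  by rewrite -catA walk_cat wp.
by rewrite -catA !(wend_cat s p).
Qed.

Lemma cyc_sign_step b S e : cyc_sign b S (src e) -> e \in S ->
  cyc_sign b S (tgt e).
Proof.
by move=> H eS; apply: (@cyc_sign_walk b S _ [:: e] H); rewrite /= eS eqxx.
Qed.

Lemma cyc_sign0 b S s c : cyc_sign b S s -> walk S s c -> wend s c = s ->
  c != [::] -> (wt c < 1)%O%g = b.
Proof. by move=> H; apply: (H [::]). Qed.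

Lemma total_walk F u n : total F -> exists2 p, walk F u p & size p = n.
Proof.
move=> tF; elim: n u => [|n IH] u; first by exists [::].
have [e eF eu] := tF u; have [p wp sp] := IH (tgt e).
by exists (e :: p); rewrite /= ?eF ?eu ?eqxx ?sp.
Qed.

Lemma total_cycle F u : total F -> exists p c,
  [/\ walk F u (p ++ c), wend u (p ++ c) = wend u p & c != [::]].
Proof.
move=> tF; have [p wp sp] := total_walk u #|V| tF.
have [|p1 [c [p2 [ep c0 ec]]]] := long_walk_cycle _ wp; first by rewrite sp.
by exists p1, c; move: wp; rewrite ep catA walk_cat => /andP[-> _].
Qed.

(** Cutting nonnegative cycles out of a walk does not increase its weight. *)
Lemma shorten_walk S u p : cyc_sign false S u -> walk S u p -> exists q,
  [/\ walk S u q, wend u q = wend u p, size q <= #|V| & (wt q <= wt p)%O].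
Proof.
move=> H; have [n] := ubnP (size p); elim: n p => // n IH p.
rewrite ltnS => sp wp; case: (leqP (size p) #|V|) => [|/ltnW] lep.
  by exists p.
have [p1 [c [p2 [ep c0 ec]]]] := long_walk_cycle lep wp.
move: wp; rewrite ep catA walk_cat ec => /andP[w1 w2].
have /negbT := H p1 c w1 ec c0; rewrite -leNgt => c1.
move: w1; rewrite walk_cat => /andP[w1 _].
have [||q [wq eq sq lq]] := IH (p1 ++ p2).
- apply: leq_trans sp; rewrite ep !size_cat ltn_add2l -[ltnLHS]add0n ltn_add2r.
  by rewrite lt0n size_eq0.
- by rewrite walk_cat w1.
exists q; split => //; first by rewrite eq 2!wend_cat ec.
apply: le_trans lq _; rewrite !wt_cat -mulgA leg_mul2l //.
by rewrite -[leLHS]mul1g leg_mul2r.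
Qed.

(** Distances exist: only the finitely many walks that are no longer than the
    number of nodes compete for the minimum. *)
Lemma min_walk S u v r : cyc_sign false S u -> walk S u r -> wend u r = v ->
  exists2 m, walk S u m /\ wend u m = v &
    forall q, walk S u q -> wend u q = v -> (wt m <= wt q)%O.
Proof.
move=> H wr er; have [r0 [wr0 er0 sr0 _]] := shorten_walk H wr.
pose P (q : #|V|.-bseq E) := walk S u q && (wend u q == v).
have P0 : P (Bseq sr0) by rewrite /P /= wr0 er0 er eqxx.
case: (@arg_minP _ G _ (Bseq sr0) P (fun q : #|V|.-bseq E => wt q) P0) => m.
case/andP=> wm /eqP em mmin.
exists m => // q wq eq; have [q' [wq' eq' sq' lq']] := shorten_walk H wq.
apply: le_trans lq'; apply: (mmin (Bseq sq')).
by rewrite /P /= wq' eq' eq eqxx.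
Qed.

End Walks.

(** * Sub-arenas, strategies and determinacy *)

Section Determinacy.
Context {d : Order.disp_t} {G : orderedGroupType d}.
Context {V E : finType} (src tgt : E -> V) (w : E -> G) (owner : V -> bool).
Implicit Types (F S T : {set E}) (u v x s : V) (p q c r : seq E) (b i j : bool).
Local Notation walk := (walk src tgt).
Local Notation wend := (wend tgt).
Local Notation wt := (wt w).
Local Notation total := (total src).
Local Notation cyc_sign := (cyc_sign src tgt w).

(** A positional strategy is encoded by the edges that remain possible once it
    is fixed: all those of the other player, and one out of each node of player
    [b].  This player owns the nodes where [owner] is [b] and wants cycles of
    sign [b]. *)
Definition strat b F S := [/\ S \subset F, total S,
  forall e, e \in F -> owner (src e) != b -> e \in S &
  forall e e', e \in S -> e' \in S -> owner (src e) = b -> src e = src e' ->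
    e = e'].

Definition solution b F S T := [/\ strat b F S, strat (~~ b) F T &
  forall s, cyc_sign b S s \/ cyc_sign (~~ b) T s].

Definition determined F := exists S T, solution true F S T.

Definition branching b F := exists e1 e2,
  [/\ e1 \in F, e2 \in F, e1 != e2, src e1 = src e2 & owner (src e1) = b].

Lemma solution_determined b F S T : solution b F S T -> determined F.
Proof.
case: b => -[sS sT H]; first by exists S, T.
by exists T, S; split=> // s; case: (H s); [right|left].
Qed.

Lemma determined_solution b F : determined F -> exists S T, solution b F S T.
Proof.
case=> S [T [sS sT H]]; case: b; first by exists S, T.
by exists T, S; split=> // s; case: (H s); [right|left].
Qed.

(** Played against each other, the two strategies leave a graph without dead
    ends; a cycle reachable in it would have both signs. *)
Lemma cyc_sign_excl b F S T s : strat b F S -> strat (~~ b) F T ->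
  cyc_sign b S s -> cyc_sign (~~ b) T s -> False.
Proof.
move=> [/subsetP SF tS oS _] [/subsetP TF tT oT _] HS HT.
have tST : total (S :&: T).
  move=> u; have [e eS eu] := tS u; have [e' eT eu'] := tT u.
  have [ob|nb] := eqVneq (owner u) b.
    exists e => //; rewrite inE eS /= oT ?SF // eu ob.
    by case: (b).
  by exists e' => //; rewrite inE eT andbT oS ?TF // eu'.
have [p [c [wpc epc c0]]] := total_cycle tgt s tST.
have sS : {subset S :&: T <= S} by move=> e; rewrite inE => /andP[].
have sT : {subset S :&: T <= T} by move=> e; rewrite inE => /andP[].
have := HT p c (walk_sub sT wpc) epc c0.
by rewrite (HS p c (walk_sub sS wpc) epc c0); case: (b).
Qed.

Lemma walk_transfer S T s p :
  (forall q e, walk T s q -> e \in S -> src e = wend s q -> e \in T) ->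
  walk S s p -> walk T s p.
Proof.
move=> H; elim/last_ind: p => // p e IH.
rewrite -cats1 !walk_cat /= => /and3P[/IH wp eS /andP[/eqP es _]].
by rewrite wp es eqxx (H p).
Qed.

(** * Removing one of two edges at a node *)

Section Branch.
Context (F : {set E}) (e1 e2 : E).
Context (e1F : e1 \in F) (e2F : e2 \in F) (e12 : e1 != e2).
Context (src12 : src e1 = src e2).
Local Notation v := (src e1).

(** Removing one of two parallel choices leaves no dead end, and each edge
    survives in at least one of the two graphs. *)
Definition del i := if i then F :\ e1 else F :\ e2.

Lemma del_sub i : del i \subset F.
Proof. by case: i; apply: subD1set. Qed.

Lemma del_total i : total F -> total (del i).
Proof.
move=> tF u; have [e eF eu] := tF u.
case: i; rewrite /del.
  have [ee|ne] := eqVneq e e1; last by exists e => //; rewrite !inE ne eF.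
  by exists e2; rewrite ?inE ?(eq_sym e2) ?e12 ?e2F // -src12 -ee.
have [ee|ne] := eqVneq e e2; last by exists e => //; rewrite !inE ne eF.
by exists e1; rewrite ?inE ?e12 ?e1F // src12 -ee.
Qed.

Lemma del_in i e : e \in F -> src e != v -> e \in del i.
Proof.
move=> eF nv; case: i; rewrite !inE eF andbT; apply: contraNneq nv => -> //.
by rewrite src12.
Qed.

Lemma in_del e : e \in F -> exists i, e \in del i.
Proof.
move=> eF; have [->|ne] := eqVneq e e1; last by exists true; rewrite !inE ne.
by exists false; rewrite !inE e12.
Qed.

Lemma strat_del b i S : owner v = b -> strat b (del i) S -> strat b F S.
Proof.
move=> ov [/subsetP SF tS oS uS]; split=> //.
  by apply/subsetP => e /SF /(subsetP (del_sub i)).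
move=> e eF ne; apply: oS => //; apply: del_in => //.
by apply: contraNneq ne => ->; rewrite ov.
Qed.

(** The opponent gets back the removed edge, which leaves [v].  From a node
    where the opponent wins, [v] is out of reach: otherwise both players would
    win from [v].  So the edge is useless there. *)
Lemma determined_keep b i S T : owner v = b -> solution b (del i) S T ->
  cyc_sign b S v -> determined F.
Proof.
move=> ov [sS sT H] Sv; apply: (@solution_determined b _ S
  (T :|: [set e in F | owner (src e) == b])).
split; first exact: strat_del sS.
- case: sT => /subsetP TF tT oT uT; split.
  + apply/subsetP => e; rewrite !inE => /orP[/TF /(subsetP (del_sub i)) //|].
    by case/andP.
  + by move=> u; have [e eT eu] := tT u; exists e => //; rewrite inE eT.
  + move=> e eF ne; rewrite !inE eF; apply/orP; right.
    by move: ne; case: (owner _) (b) => [] [].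
  + move=> e e'; rewrite !inE => H1 H2 o1 o12; move: H1 H2.
    rewrite -o12 o1; have -> : (~~ b == b) = false by case: (b).
    by rewrite !andbF !orbF => H1 H2; exact: uT.
move=> s; case: (H s) => [|Ts]; [by left|right].
have noT q : walk T s q -> wend s q != v.
  move=> wq; apply/eqP => eq; apply: (cyc_sign_excl sS sT Sv).
  by rewrite -eq; apply: cyc_sign_walk.
move=> p c wpc; apply: Ts; apply: walk_transfer wpc => q e wq.
rewrite !inE => /orP[//|/andP[eF oe]] es.
case: sT => _ _ oT _; apply: oT; last by rewrite (eqP oe); case: (b).
by apply: del_in => //; rewrite es; exact: noT.
Qed.

(** * Combining two strategies by distance *)

Section Combine.
Context (T : bool -> {set E}).
Context (Tstrat : forall i, strat false (del i) (T i)).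
Context (Tv : forall i, cyc_sign false (T i) v).
Context (ov : owner v = true).

(** [reach i u r] says that [r] is one of the walks whose least weight is the
    distance from [u] to [v] under the strategy [T i]. *)
Definition reach i u r := walk (T i) u r /\ wend u r = v.

(** Comparing distances without computing them: this covers infinite ones, when
    no walk reaches [v]. *)
Definition dist_le j i u := forall r, reach i u r ->
  exists2 r', reach j u r' & (wt r' <= wt r)%O.

(** The strategy preferred at [u] has the larger distance to [v] among those
    under which the cycles reachable from [u] are nonnegative.  Ties go to
    [true]: where both distances are infinite, an arbitrary alternation between
    the two strategies could close negative cycles. *)
Definition pref u : bool := `[< cyc_sign false (T true) u /\
  (cyc_sign false (T false) u -> dist_le false true u) >].

Definition safe u := cyc_sign false (T (pref u)) u.

Lemma pref_max i u : cyc_sign false (T i) u -> safe u /\ dist_le i (pref u) u.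
Proof.
have refl j : dist_le j j u by move=> r Hr; exists r.
rewrite /safe; case: (asboolP _ : reflect _ (pref u)) => [[Ht Hf]|H] Hi.
  by split=> //; case: i Hi.
case: i Hi => Hi; last by split.
have [Hf|nf] := pselect (cyc_sign false (T false) u); last by case: H.
(* [T true] is winning but not preferred: its distance is the smaller one. *)
split=> // r Hr.
have [//|no] := pselect (exists2 r', reach true u r' & (wt r' <= wt r)%O).
case: H; split=> // _ r' Hr'; exists r => //.
by case: (leP (wt r) (wt r')) => // /ltW le; case: no; exists r'.
Qed.

Definition combined := [set e in F | owner (src e) || (e \in T (pref (src e)))].

Lemma opponent_sub i e : e \in T i -> e \in F.
Proof. by case: (Tstrat i) => /subsetP sT _ _ _ /sT /(subsetP (del_sub i)). Qed.

Lemma combined_strat : strat false F combined.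
Proof.
split.
- by apply/subsetP => e; rewrite inE => /andP[].
- move=> u; have [_ tT _ _] := Tstrat (pref u).
  have [e eT eu] := tT u; exists e => //.
  by rewrite inE (opponent_sub eT) eu eT orbT.
- by move=> e eF; rewrite inE eF; case: (owner _).
move=> e e'; rewrite !inE => /andP[_ He] /andP[_ He'] o es.
move: He He'; rewrite -es o /= => He He'.
by have [_ _ _] := Tstrat (pref (src e)); apply.
Qed.

(** An edge of the combined strategy follows the preferred strategy, except at
    [v]: there all edges are allowed, and each belongs to [T true] or [T false],
    both of which are winning at [v]. *)
Lemma combined_edge e : e \in combined -> safe (src e) ->
  exists i, [/\ e \in T i, cyc_sign false (T i) (src e) &
    i = pref (src e) \/ src e = v].
Proof.
rewrite inE => /andP[eF]; case oe: (owner _) => /= eT sf; last first.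
  by exists (pref (src e)); split=> //; left.
have [ev|nv] := eqVneq (src e) v; last first.
  exists (pref (src e)); split=> //; last by left.
  by have [_ _ oT _] := Tstrat (pref (src e)); apply: oT; rewrite ?oe ?del_in.
have [i ei] := in_del eF; exists i; split; rewrite ?ev //; last by right.
by have [_ _ oT _] := Tstrat i; apply: oT; rewrite ?oe.
Qed.

Lemma combined_safe e : e \in combined -> safe (src e) -> safe (tgt e).
Proof.
move=> ec sf; have [i [eT ci _]] := combined_edge ec sf.
by have [] := pref_max (cyc_sign_step ci eT).
Qed.

(** The potential inequality: the distance at the source is at most the weight
    of the edge plus the distance at the target.  If the edge lies in [T i], it
    holds for the distance under [T i], and the preferred distance at the target
    is at least that one.  At [v] the distance is zero, and the inequality says
    that the cycle closed by the edge is nonnegative. *)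
Lemma combined_dist e r : e \in combined -> safe (src e) ->
  reach (pref (tgt e)) (tgt e) r ->
  exists2 r', reach (pref (src e)) (src e) r' & (wt r' <= wt (e :: r))%O.
Proof.
move=> ec sf Hr; have [i [eT ci Hi]] := combined_edge ec sf.
have [_ dle] := pref_max (cyc_sign_step ci eT).
have [ri [wi ei] li] := dle _ Hr.
have We : walk (T i) (src e) (e :: ri) by rewrite /= eT eqxx.
have le : (wt (e :: ri) <= wt (e :: r))%O by rewrite !wt_cons leg_mul2l.
case: Hi => [ei'|ev]; first by exists (e :: ri) => //; split; rewrite -?ei'.
(* Here [src e = v], and the empty walk realizes the distance zero. *)
exists [::]; first by split.
apply: le_trans le; rewrite wt_nil leNgt.
by rewrite (cyc_sign0 ci We) // {2}ev -ei.
Qed.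

Lemma combined_walk u q : walk combined u q -> safe u ->
  safe (wend u q) /\ forall r, reach (pref (wend u q)) (wend u q) r ->
    exists2 r', reach (pref u) u r' & (wt r' <= wt (q ++ r))%O.
Proof.
elim: q u => [|e q IH] u /=; first by move=> _ sf; split=> // r; exists r.
case/and3P => ec /eqP <- wq sf.
have [sf' H] := IH _ wq (combined_safe ec sf); split=> // r /H [r1 Hr1 l1].
have [r' Hr' l'] := combined_dist ec sf Hr1; exists r' => //.
by apply: le_trans l' _; rewrite !wt_cons leg_mul2l.
Qed.

(** Where the preferred distance is infinite, no finite potential exists.  There
    each edge belongs to the strategy preferred at its source, and the
    preference never turns from [true] to [false], because an infinite
    distance under [T true] stays infinite along the edges of [T true], and ties
    go to [true]. *)
Lemma combined_unreachable u e q : walk combined u (e :: q) -> safe u ->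
  (forall r, ~ reach (pref u) u r) ->
  [/\ e \in T (pref u), (pref u -> pref (tgt e)), safe (tgt e) &
    forall r, ~ reach (pref (tgt e)) (tgt e) r].
Proof.
rewrite /= => /and3P[ec /eqP <- wq] sf no.
have no' r : ~ reach (pref (tgt e)) (tgt e) r.
  by move=> Hr; have [r' Hr' _] := combined_dist ec sf Hr; apply: no Hr'.
have [i [eT ci [ei|ev]]] := combined_edge ec sf; last first.
  by case: (no [::]); split.
have sf' := combined_safe ec sf.
rewrite -ei; split=> // it; rewrite it in ei eT ci.
apply/asboolP; split; first exact: cyc_sign_step eT.
move=> _ r [wr er]; case: (no (e :: r)); rewrite -ei.
by split=> //=; rewrite eT eqxx.
Qed.

Lemma combined_pref u q : walk combined u q -> safe u ->
  (forall r, ~ reach (pref u) u r) -> pref u -> pref (wend u q).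
Proof.
elim: q u => //= e q IH u wq sf no pu.
have [_ /(_ pu) pe se no'] := combined_unreachable wq sf no.
by case/and3P: wq => _ _ wq; apply: IH.
Qed.

(** On a cycle the preference is the same at both ends; as it can only change
    from [false] to [true], it is constant. *)
Lemma combined_stay u q : walk combined u q -> safe u ->
  (forall r, ~ reach (pref u) u r) -> pref (wend u q) = pref u ->
  walk (T (pref u)) u q.
Proof.
elim: q u => //= e q IH u wq sf no pu.
have [eT pe se no'] := combined_unreachable wq sf no.
case/and3P: wq => ec eu wq.
have eqp : pref (tgt e) = pref u.
  apply/idP/idP => [pt|/pe //]; rewrite -pu.
  exact: (combined_pref wq se no' pt).
by rewrite eT eu -eqp IH // -?eqp //= eqp.
Qed.

(** With a finite distance [m] at [u], the potential inequality around the cycle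
    gives [m <= wt c * m].  With an infinite one, the cycle lies in the graph of
    a single strategy. *)
Lemma combined_cycle u c : walk combined u c -> safe u -> wend u c = u ->
  c != [::] -> (wt c < 1)%O%g = false.
Proof.
move=> wc sf ec c0.
have [[r Hr]|no] := pselect (exists r, reach (pref u) u r); last first.
  apply: (cyc_sign0 sf) => //; apply: combined_stay => //; last by rewrite ec.
  by move=> r Hr; apply: no; exists r.
have [m Hm mmin] := min_walk sf Hr.1 Hr.2.
have [_] := combined_walk wc sf; rewrite ec => /(_ m Hm) [r' [wr' er'] lr'].
have := le_trans (mmin _ wr' er') lr'.
rewrite wt_cat -{1}[wt m]mul1g => lm; apply/negbTE.
by rewrite -(ltg_mul2r (wt m)) -leNgt.
Qed.

Lemma combined_cyc_sign s : safe s -> cyc_sign false combined s.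
Proof.
move=> sf p c; rewrite walk_cat wend_cat => /andP[wp wc] ec.
by have [sf' _] := combined_walk wp sf; apply: combined_cycle wc _ _.
Qed.

End Combine.

Lemma determined_combine (S T : bool -> {set E}) : owner v = true ->
  (forall i, solution true (del i) (S i) (T i)) ->
  (forall i, cyc_sign false (T i) v) -> determined F.
Proof.
move=> ov ST Tv; have Ts i : strat false (del i) (T i) by case: (ST i).
exists (S true), (combined T).
have [sS _ H] := ST true; split; first exact: strat_del sS.
  exact: combined_strat.
move=> s; case: (H s) => [|Hs]; [by left|right].
apply: combined_cyc_sign => //.
by have [] := pref_max Hs.
Qed.

(** * Decomposition of cycles at a node *)

Lemma walk_del i x q : walk F x q -> all (fun e => src e != v) q ->
  walk (del i) x q.
Proof.
by elim: q x => //= e q IH x /and3P[eF -> wq] /andP[ne nq]; rewrite del_in ?IH.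
Qed.

(** The last visit is wanted: the walk [e :: c] uses a single edge out of [v],
    so it lies entirely in one of the graphs [del i]. *)
Lemma last_visit q : has (fun e => src e == v) q ->
  exists a e c, [/\ q = a ++ e :: c, src e = v & all (fun e => src e != v) c].
Proof.
elim: q => //= e q IH.
have [/IH [a [e' [c [-> ev nc]]]] _|nh] := boolP (has _ q).
  by exists (e :: a), e', c.
rewrite orbF => /eqP ev; exists [::], e, q; split=> //.
by rewrite all_predC.
Qed.

(** A closed walk at [v] is cut at its visits of [v]; each piece uses a single
    edge out of [v], hence lies in one of the graphs [del i]. *)
Lemma del_loop b c : (forall i, cyc_sign b (del i) v) ->
  walk F v c -> wend v c = v -> c != [::] -> (wt c < 1)%O%g = b.
Proof.
move=> H; have [n] := ubnP (size c); elim: n c => // n IH [//|e c].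
rewrite ltnS => sc wc ec _.
have [hc|nc] := boolP (has (fun e => src e == v) c); last first.
  case/and3P: wc => eF ev wc; have [i ei] := in_del eF.
  apply: (cyc_sign0 (H i)) => //=; rewrite ei ev walk_del //.
  by rewrite all_predC.
have [a [e' [c' [def_c e'v _]]]] := last_visit hc.
move: wc ec; rewrite def_c -cat_cons walk_cat => /andP[wa wc'] ec.
have ea : wend v (e :: a) = v by move: wc' => /= /and3P[_ /eqP <-].
rewrite ea in wc'; rewrite wend_cat ea in ec.
have {}sc : size (e :: a) < n /\ size (e' :: c') < n.
  move: sc; rewrite def_c /= size_cat /= addnS => sc.
  by split; apply: leq_trans sc; rewrite !ltnS ?leq_addr ?leq_addl.
by rewrite wt_cat; apply: ltg1_mul; apply: IH; case: sc.
Qed.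

(** A cycle through [v] is a rotation of a loop at [v].  A cycle that avoids [v]
    but is reached through [v] is reached from [v] inside one of the graphs
    [del i]; otherwise [v] does not occur at all. *)
Lemma cyc_sign_union b s : (forall i, cyc_sign b (del i) v) ->
  cyc_sign b (del true) s -> cyc_sign b F s.
Proof.
move=> H Hs p c wpc epc c0; have Hv := del_loop H.
move: (wpc); rewrite walk_cat => /andP[wp wc]; rewrite wend_cat in epc.
have [hc|nc] := boolP (has (fun e => src e == v) c).
  have [a [e [c' [ec ev _]]]] := last_visit hc.
  move: wc epc; rewrite ec wt_cat ltg1_rot -wt_cat walk_cat wend_cat.
  case/andP=> wa wec eec; have ea : wend (wend s p) a = v.
    by move: wec => /= /and3P[_ /eqP <-].
  rewrite ea in wec eec; apply: Hv => //; first by rewrite walk_cat wec eec.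
  by rewrite wend_cat eec.
have wci i : walk (del i) (wend s p) c by rewrite walk_del // all_predC.
have [hp|np] := boolP (has (fun e => src e == v) p); last first.
  apply: (Hs p) => //; rewrite ?wend_cat //.
  by rewrite walk_cat wci walk_del // all_predC.
have [a [e [p' [ep ev np']]]] := last_visit hp.
move: wp wci epc; rewrite ep walk_cat wend_cat => /andP[wa].
rewrite /= => /and3P[eF /eqP eva wp'] wci epc.
have [i ei] := in_del eF; apply: (H i (e :: p')); rewrite ?wend_cat //.
  rewrite walk_cat -{2}ev eva wci /= ei ev eqxx /=.
  by rewrite (walk_del _ wp').
Qed.

Lemma strat_forced b F' S :
  total F' -> ~ branching b F' -> strat b F' S -> S = F'.
Proof.
move=> tF nb [/subsetP SF tS oS _].
apply/setP => e; apply/idP/idP => [/SF //|eF].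
have [ob|] := eqVneq (owner (src e)) b; last exact: oS.
have [e' eS' es'] := tS (src e).
have [->//|ne] := eqVneq e e'; case: nb; exists e, e'.
by split=> //; exact: SF.
Qed.

Lemma strat_full b F' : total F' -> ~ branching b F' -> strat b F' F'.
Proof.
move=> tF nb; split=> // e e' eF eF' ob es.
by have [//|ne] := eqVneq e e'; case: nb; exists e, e'.
Qed.

Lemma determined_union b (S T : bool -> {set E}) : total F -> owner v = b ->
  ~ branching (~~ b) F -> (forall i, solution b (del i) (S i) (T i)) ->
  (forall i, cyc_sign (~~ b) (T i) v) -> determined F.
Proof.
move=> tF ov nb ST Tv; apply: (@solution_determined b _ (S true) F).
have eT i : T i = del i.
  case: (ST i) => _ + _; apply: strat_forced; first exact: del_total.
  case=> [f [f' [fi fi' ff ss oo]]]; apply: nb; exists f, f'.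
  by split=> //; apply/(subsetP (del_sub i)).
have [sS _ H] := ST true; split; [exact: strat_del sS|exact: strat_full|].
move=> s; case: (H s) => [|Hs]; [by left|right].
by apply: cyc_sign_union; rewrite -?eT // => i; rewrite -eT.
Qed.

End Branch.
(** * Graphs without choices, and determinacy *)

Section Deterministic.
Context (F : {set E}).
Context (Fdet :
  forall e e', e \in F -> e' \in F -> src e = src e' -> e = e').

Lemma det_prefix u p q : walk F u p -> walk F u q -> size p <= size q ->
  p = take (size p) q.
Proof.
elim: p u q => [|e p IH] u [|e' q] //=.
case/and3P=> eF /eqP eu wp /and3P[eF' /eqP eu' wq] le.
have ee : e = e' by apply: Fdet; rewrite ?eu.
by rewrite -{}ee in wq *; rewrite -(IH _ _ wp wq).
Qed.

Definition cpow c k : seq E := flatten (nseq k c).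

Lemma cpow_closed u c k : walk F u c -> wend u c = u ->
  walk F u (cpow c k) /\ wend u (cpow c k) = u.
Proof.
move=> wc ec; elim: k => //= k [IH1 IH2].
by rewrite /cpow /= walk_cat wend_cat ec wc.
Qed.

Lemma size_cpow c k : size (cpow c k) = k * size c.
Proof. by elim: k => //= k IH; rewrite /cpow /= size_cat -/(cpow c k) IH. Qed.

Lemma wt_cpow c k : 0 < k -> (wt (cpow c k) < 1)%O%g = (wt c < 1)%O%g.
Proof.
case: k => // k _; elim: k => [|k IH]; first by rewrite /cpow /= cats0.
by rewrite /cpow /= wt_cat; apply: ltg1_mul => //; apply: IH.
Qed.

(** One walk is a prefix of the other, so the second cycle starts at a node that
    the first one runs through: a rotation [q ++ r] of a power of the first
    cycle starts there too.  Repeated to a common length, the two coincide. *)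
Lemma det_same_sign s p1 c1 p2 c2 :
  walk F s (p1 ++ c1) -> wend s (p1 ++ c1) = wend s p1 -> c1 != [::] ->
  walk F s (p2 ++ c2) -> wend s (p2 ++ c2) = wend s p2 -> c2 != [::] ->
  (wt c1 < 1)%O%g = (wt c2 < 1)%O%g.
Proof.
wlog le : p1 c1 p2 c2 / size p1 <= size p2.
  move=> H; case: (leqP (size p1) (size p2)) => [|/ltnW] le *.
    exact: (H p1 _ p2).
  by symmetry; apply: (H p2 _ p1).
rewrite !walk_cat !wend_cat -!size_eq0 -!lt0n.
move=> /andP[wp1 wc1] ec1 c10 /andP[wp2 wc2] ec2 c20.
have ep2 := cat_take_drop (size p1) p2; rewrite -(det_prefix wp1 wp2 le) in ep2.
move: (drop _ _) ep2 wp2 wc2 ec2 => r <-.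
rewrite walk_cat wend_cat => /andP[_ wr].
move: (wend s p1) wc1 ec1 wr => u wc1 ec1 wr wc2 ec2.
have [wk ek] := cpow_closed (size r).+1 wc1 ec1.
have sk : size r <= size (cpow c1 (size r).+1).
  by rewrite size_cpow mulSn (leq_trans _ (leq_addl _ _)) // leq_pmulr.
have ekr := cat_take_drop (size r) (cpow c1 (size r).+1).
rewrite -(det_prefix wr wk sk) in ekr.
move: (drop _ _) ekr => q ekr.
rewrite -(@wt_cpow c1 (size r).+1) // -ekr wt_cat ltg1_rot -wt_cat.
move: wk ek; rewrite -ekr walk_cat wend_cat wr /= => wq eq.
have c30 : 0 < size (q ++ r).
  by rewrite size_cat addnC -size_cat ekr size_cpow mulSn ltn_addr.
have [w3 e3] :
    walk F (wend u r) (q ++ r) /\ wend (wend u r) (q ++ r) = wend u r.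
  by rewrite walk_cat wend_cat eq wq.
have [w2k _] := cpow_closed (size (q ++ r)) wc2 ec2.
have [w3k _] := cpow_closed (size c2) w3 e3.
rewrite -(wt_cpow (q ++ r) c20) -(wt_cpow c2 c30).
have es : size (cpow (q ++ r) (size c2)) = size (cpow c2 (size (q ++ r))).
  by rewrite !size_cpow mulnC.
by rewrite (det_prefix w3k w2k) ?es // take_size.
Qed.

Lemma det_cyc_sign s : cyc_sign true F s \/ cyc_sign false F s.
Proof.
have [H|H] := pselect (cyc_sign true F s); [by left|right].
move=> p c wpc epc c0; apply/negbTE/negP => neg; apply: H.
move=> p' c' wpc' epc' c0'.
by rewrite -(det_same_sign wpc epc c0 wpc' epc' c0').
Qed.

End Deterministic.

(** The branchings of the player who wants negative cycles are removed first,
    since [determined_union] requires that this player has no choice left. *)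
Theorem positional_determinacy F : total F -> determined F.
Proof.
have [n] := ubnP #|F|; elim: n F => // n IH F; rewrite ltnS => leF tF.
have step b e1 e2 : e1 \in F -> e2 \in F -> e1 != e2 -> src e1 = src e2 ->
    owner (src e1) = b -> determined F \/ exists S T : bool -> {set E},
      (forall i, solution b (del F e1 e2 i) (S i) (T i)) /\
      forall i, cyc_sign (~~ b) (T i) (src e1).
  move=> e1F e2F e12 s12 ov.
  have D i : exists ST, solution b (del F e1 e2 i) ST.1 ST.2.
    have [|S [T ST]] := @determined_solution b (del F e1 e2 i); last first.
      by exists (S, T).
    apply: IH; last exact: del_total.
    apply: leq_trans leF; case: i; rewrite /del.
      by rewrite [leqRHS](cardsD1 e1) e1F.
    by rewrite [leqRHS](cardsD1 e2) e2F.
  have [ST H] := choice D.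
  have [[i Hi]|no] := pselect (exists i, cyc_sign b (ST i).1 (src e1)).
    by left; apply: (determined_keep s12 ov (H i) Hi).
  right; exists (fun i => (ST i).1), (fun i => (ST i).2); split=> // i.
  by have [_ _ /(_ (src e1)) []] := H i => // Hi; case: no; exists i.
have [[e1 [e2 [e1F e2F e12 s12 ov]]]|nbt] := pselect (branching true F).
  have [//|[S [T [H Tv]]]] := step true _ _ e1F e2F e12 s12 ov.
  exact: (determined_combine e1F e12 s12 ov H Tv).
have [[e1 [e2 [e1F e2F e12 s12 ov]]]|nbf] := pselect (branching false F).
  have [//|[S [T [H Tv]]]] := step false _ _ e1F e2F e12 s12 ov.
  exact: (determined_union e1F e2F e12 s12 tF ov nbt H Tv).
exists F, F; split; [exact: strat_full|exact: strat_full|].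
apply: det_cyc_sign => e e' eF eF' es; have [//|ne] := eqVneq e e'.
by case ob: (owner (src e)); [case: nbt|case: nbf]; exists e, e'.
Qed.

End Determinacy.

(** * From signs of cycles to plays *)

Lemma recurrent_value (V : finType) (f : nat -> V) :
  exists u, forall n, exists2 m, n < m & f m = u.
Proof.
apply: contrapT => H.
have /choice[N HN] u : exists n, forall m, n < m -> f m <> u.
  apply: contrapT => Hu; apply: H; exists u => n.
  apply: contrapT => Hn; apply: Hu; exists n => m nm fm.
  by apply: Hn; exists m.
(* Beyond the last occurrence of every value, nothing is left for [f m]. *)
pose m := (\max_u N u).+1.
by apply: (HN (f m) m) => //; rewrite ltnS leq_bigmax.
Qed.

Section Plays.
Context {d : Order.disp_t} {G : orderedGroupType d}.
Context {C : finType} (val : C -> G).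
Context (A : arena C).
Let weight (e : edge A) : G := val (col e).
Local Notation E := (edge A : finType).
Local Notation V := (node A).
Implicit Types (S : {set E}) (p : nat -> E) (b : bool).
Local Notation walk := (@walk V E (@source C A) (@target C A)).
Local Notation wend := (@wend V E (@target C A)).
Local Notation wt := (@wt d G E weight).
Local Notation cyc_sign :=
  (@cyc_sign d G V E (@source C A) (@target C A) weight).

Definition segment p n k : seq E := map p (iota n k).

Lemma segment_walk S s p n k : is_play s p -> (forall n, p n \in S) ->
  walk S (source (p n)) (segment p n k) /\
  wend (source (p n)) (segment p n k) = source (p (n + k)).
Proof.
move=> [_ pl] pS; elim: k n => [|k IH] n; first by rewrite addn0.
have [wk ek] := IH n.+1; rewrite /= pS eqxx -pl; split=> //.
by rewrite wend_cons -pl -addSnnS -ek.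
Qed.

Lemma play_prefix_value p n :
  word_val val (mkseq (play_word p) n) = wt (segment p 0 n).
Proof. by rewrite wtE /word_val /segment /mkseq !big_map. Qed.

(** The two prefix values differ by the weight of the cycle between them, as a
    factor on the right, and cancellation on the left preserves the order. *)
Lemma play_cycle b S s p i j : is_play s p -> (forall n, p n \in S) ->
  cyc_sign b S s -> i < j -> source (p i) = source (p j) ->
  (word_val val (mkseq (play_word p) j)
    < word_val val (mkseq (play_word p) i))%O = b.
Proof.
move=> pl pS H ij es; rewrite !play_prefix_value.
have ej : segment p 0 j = segment p 0 i ++ segment p i (j - i).
  by rewrite /segment -map_cat -{2}[i]add0n -iotaD subnKC // ltnW.
have [w0 e0] := segment_walk 0 i pl pS.
have [wi ei] := segment_walk i (j - i) pl pS.
rewrite add0n (proj1 pl) in w0 e0.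
rewrite ej wt_cat -[ltRHS]mulg1 ltg_mul2l; apply: (H (segment p 0 i)).
- by rewrite walk_cat w0 e0.
- by rewrite wend_cat e0 ei subnKC // ltnW.
- by rewrite -size_eq0 size_map size_iota subn_eq0 -ltnNge.
Qed.

Lemma play_energy S s p : is_play s p -> (forall n, p n \in S) ->
  cyc_sign true S s -> energy_condition val (play_word p).
Proof.
move=> pl pS H; have [u Hu] := recurrent_value (fun n => source (p n)).
have [n|g Hg] := @choice _ _ (fun n m => n < m /\ source (p m) = u).
  by have [m] := Hu n; exists m.
(* Starting the iteration at [g 0] makes every index positive. *)
pose f i := iter i.+1 g 0.
have fu i : source (p (f i)) = u by have [] := Hg (iter i g 0).
have f_homo : {homo f : i j / i < j}.
  by apply: homo_ltn => [|i]; [exact: ltn_trans | have [] := Hg (f i)].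
exists f; split=> // [i|i j ij].
  by apply: leq_trans (proj1 (Hg _)).
by apply: (play_cycle pl pS H); rewrite ?fu // f_homo.
Qed.

Lemma play_not_energy S s p : is_play s p -> (forall n, p n \in S) ->
  cyc_sign false S s -> ~ energy_condition val (play_word p).
Proof.
move=> pl pS H [f [_ f_homo f_dec]].
pose g (i : 'I_(#|V|.+1)) := source (p (f i)).
have /injectivePn[i [j neij eqg]] : ~~ injectiveb g.
  by apply/negP => /injectiveP /leq_card; rewrite card_ord ltnn.
wlog ltij : i j neij eqg / i < j.
  move=> W; case: (ltngtP i j) => [ij|ji|/val_inj eqij].
  - exact: (W i j).
  - by apply: (W j i) => //; rewrite eq_sym.
  - by rewrite eqij eqxx in neij.
have := f_dec _ _ ltij.
by rewrite (play_cycle pl pS H _ eqg) // f_homo.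
Qed.

End Plays.

Definition alice (C : finType) (A : arena C) (s : node A) : bool :=
  if s is inl _ then true else false.

(** The nodes of Alice are given to player [b] of the cycle game, those of Bob
    to the other one.  Bob's winning strategy obtained here is positional as
    well, and does not depend on the start. *)
Lemma half_positional_cycles (d : Order.disp_t) (G : orderedGroupType d)
    (C : finType) (val : C -> G) (W : omega_word C -> Prop) (b : bool) :
  (forall (A : arena C) (S : {set (edge A : finType)}) s p,
    is_play s p -> (forall n, p n \in S) ->
    cyc_sign (@source C A) (@target C A) (fun e => val (col e)) b S s ->
    W (play_word p)) ->
  (forall (A : arena C) (S : {set (edge A : finType)}) s p,
    is_play s p -> (forall n, p n \in S) ->
    cyc_sign (@source C A) (@target C A) (fun e => val (col e)) (~~ b) S s ->
    ~ W (play_word p)) ->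
  half_positional W.
Proof.
move=> Wb Wnb A; pose E : finType := edge A; pose V := node A.
pose owner (s : V) := alice s == b.
have tA : total (@source C A) [set: E].
  move=> s; have [c [t est]] := edges_total (a := A) s.
  by exists (exist _ (s, c, t) est).
have [S [T [sS sT H]]] := determined_solution b
  (positional_determinacy (@target C A) (fun e : E => val (col e)) owner tA).
have select (R : {set E}) : total (@source C A) R ->
    exists f : V -> E, forall u, f u \in R /\ source (f u) = u.
  move=> tR; have [u|f Hf] := choice (P := fun u e => e \in R /\ source e = u).
    by have [e] := tR u; exists e.
  by exists f.
have ownerA (s : V) : (owner s == b) = alice s.
  by rewrite /owner; case: (alice s) (b) => [] [].
have [_ tS oS uS] := sS; have [_ tT oT uT] := sT.
have [fS HfS] := select S tS; have [fT HfT] := select T tT.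
exists (fun u => fS (inl u)); split=> [u|s nwin].
  by have [] := HfS (inl u).
have cT :
    cyc_sign (@source C A) (@target C A) (fun e => val (col e)) (~~ b) T s.
  case: (H s) => // cS; case: nwin => p pl cons.
  apply: (Wb A S s p pl _ cS) => n; case es: (source (p n)) => [u|u].
    by rewrite (cons _ _ es); case: (HfS (inl u)).
  by apply: oS; rewrite ?inE // ownerA es.
exists (fun s h => fT (path_end s h)); split=> [s' h v _ ev|p pl cons].
  by have [_ ->] := HfT (path_end s' h).
apply: (Wnb A T s p pl _ cT) => n.
case es: (source (p n)) => [u|u]; last first.
  by rewrite (cons _ _ es); case: (HfT (path_end s (mkseq p n))).
apply: oT; rewrite ?inE //; move: (ownerA (inl u)); rewrite es.
by case: (owner _) (b) => [] [].
Qed.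

Theorem theorem2 (C : finType) (C_nonempty : 0 < #|C|) (d : Order.disp_t)
  (G : orderedGroupType d) (val : C -> G) :
  bi_positional (energy_condition val).
Proof.
split.
  apply: (@half_positional_cycles d G C val _ true) => A S s p.
    exact: play_energy.
  exact: play_not_energy.
apply: (@half_positional_cycles d G C val _ false) => A S s p pl pS H.
  exact: play_not_energy pl pS H.
by apply; apply: play_energy pl pS H.
Qed.
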